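(* Let $k\ge 1$ be an integer, let $\Gamma$ be an abelian group, let $A_1,\dots,A_k,B$ be finite subsets of $\Gamma$, let $W,Y\subseteq\Gamma^k$ and $X,Z\subseteq\Gamma$ be finite. Then $$|W\times X|\,|Y-\Delta(Z)| \le |Y\times W\times Z-\Delta(X)|,$$ $$|A_1\times\dots\times A_k-\Delta(B)| \le |A_1\times\dots\times A_m-\Delta(A_{m+1})|\,|A_{m+1}\times\dots\times A_k-\Delta(B)| \quad\text{for every } m\in\{1,\dots,k-1\},$$ and $$|Y\times Z-\Delta(X)| = |Y\times X-\Delta(Z)|.$$
   Context: For a positive integer $n$ and $T\subseteq\Gamma$, $\Delta(T)=\Delta_n(T)=\{(t,\dots,t)\in\Gamma^n: t\in T\}$, where $n$ is the dimension of the ambient product. For $S\subseteq\Gamma^n$ and $T\subseteq\Gamma$, $S-\Delta(T)=\{(s_1-t,\dots,s_n-t): (s_1,\dots,s_n)\in S,\ t\in T\}\subseteq\Gamma^n$. Products such as $Y\times W\times Z$ are regarded as subsets of $\Gamma^{2k+1}$, and $Y\times Z$, $Y\times X$ as subsets of $\Gamma^{k+1}$. *)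

(* Defs.v *)
From HB Require Import structures.
From mathcomp Require Import all_boot all_order all_algebra finmap.

Set Implicit Arguments.
Unset Strict Implicit.
Unset Printing Implicit Defensive.

Import GRing.Theory.

Local Open Scope ring_scope.
Local Open Scope fset_scope.

(* Gamma^n is the group 'rV[G]_n of row vectors, G being Gamma; const_mx t is the
   vector (t, ..., t). *)

Section Defs.
Variable G : zmodType.

Definition diag (n : nat) (T : {fset G}) : {fset 'rV[G]_n} :=
  [fset (const_mx t : 'rV[G]_n) | t in T].

Definition diffset (n : nat) (S D : {fset 'rV[G]_n}) : {fset 'rV[G]_n} :=
  [fset s - d | s in S, d in D].

Definition prodv (m n : nat) (S : {fset 'rV[G]_m}) (T : {fset 'rV[G]_n}) :
    {fset 'rV[G]_(m + n)} :=
  [fset row_mx s t | s in S, t in T].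

Definition fset_rV1 (T : {fset G}) : {fset 'rV[G]_1} :=
  [fset (\row_(i < 1) t) | t in T].

(* The functions f range over the choices of f i in A i for each i; see
   in_boxprod. *)
Definition boxprod (n : nat) (A : 'I_n -> {fset G}) : {fset 'rV[G]_n} :=
  [fset (\row_i fsval (f i)) | f : {dffun forall i : 'I_n, A i} in predT].

Lemma in_boxprod (n : nat) (A : 'I_n -> {fset G}) (v : 'rV[G]_n) :
  reflect (forall i, v 0 i \in A i) (v \in boxprod A).
Proof.
apply: (iffP (imfsetP _ _ _ _)) => [[f _ ->] i|vA]; first by rewrite mxE fsvalP.
exists (finfun (fun i => [` vA i])) => //.
by apply/rowP => i; rewrite mxE ffunE.
Qed.

End Defs.

(* Ordinals count from 0, so for m : 'I_k a family A_1, ..., A_k is split into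
   A_1, ..., A_m and A_(m+1), ..., A_k, and A m is A_(m+1). *)
Definition family_take (T : Type) (k : nat) (m : 'I_k) (A : 'I_k -> T) :
    'I_m -> T :=
  fun i => A (widen_ord (ltnW (ltn_ord m)) i).

Definition family_drop (T : Type) (k : nat) (m : 'I_k) (A : 'I_k -> T) :
    'I_(k - m) -> T :=
  fun i => A (cast_ord (subnKC (ltnW (ltn_ord m))) (rshift m i)).

Arguments family_take {T k} m A i.
Arguments family_drop {T k} m A i.

Notation "S `-D` T" := (diffset S (diag _ T))
  (at level 50, left associativity) : fset_scope.
Notation "S `x` T" := (prodv S T)
  (at level 40, left associativity) : fset_scope.

(* Main.v *)
Require Import Defs.
From HB Require Import structures.
From mathcomp Require Import all_boot all_order all_algebra finmap.

(** Part one is Ruzsa's triangle argument: once [u = y - Delta(z)] has been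
  written as a difference in a fixed way, [((w, x), u)] is recovered from
  [(y, w, z) - Delta(x)], because subtracting the last coordinate from the first
  block gives [u], hence [y] and [z], hence [x], hence [w].  The other two parts
  use explicit injections that need no choice of representatives:
  [v |-> ((v_i - v_(m+1))_(i <= m), (v_j)_(j > m))] and
  [(p, q) |-> (p - Delta(q), - q)]. *)

Import GRing.Theory.
Local Open Scope ring_scope.
Local Open Scope fset_scope.

Lemma leq_card_fset_inj (K L : choiceType) (f : K -> L) (S : {fset K})
    (T : {fset L}) :
    {in S &, injective f} -> {in S, forall x, f x \in T} ->
  (#|` S| <= #|` T|)%N.
Proof.
move=> injf fST; rewrite -(card_in_imfset imfset_key injf).
by apply/fsubset_leq_card/fsubsetP => _ /imfsetP[x /= xS ->]; apply: fST.
Qed.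

Lemma cardfsM (K L : choiceType) (S : {fset K}) (T : {fset L}) :
  #|` S `*` T| = (#|` S| * #|` T|)%N.
Proof.
rewrite -(size_allpairs pair); apply/perm_size/uniq_perm => [||[x y]].
- exact: fset_uniq.
- by apply: allpairs_uniq => // -[x y] [x' y'].
rewrite in_fsetM /=; apply/andP/allpairsP => [[xS yT]|[[x' y'] /= [? ? [-> ->]]]].
  by exists (x, y).
by [].
Qed.

(** Provides the fixed choice of representatives for the triangle argument. The default [x0] is the
    value of [g] off the image only, so [S] may be empty. *)
Lemma imfset_section (K L : choiceType) (x0 : K) (f : K -> L) (S : {fset K}) :
  {g : L -> K | forall u, (exists2 x, x \in S & u = f x) ->
                  g u \in S /\ f (g u) = u}.
Proof.
exists (fun u => if [pick x : S | f (fsval x) == u] is Some x then fsval x else x0).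
move=> _ [x xS ->]; case: pickP => [y /eqP|/(_ [` xS])]; first by split; rewrite ?fsvalP.
by rewrite /= eqxx.
Qed.

Section DiffsetCard.
Variable G : zmodType.

Lemma in_diffsetP (n : nat) (S : {fset 'rV[G]_n}) (T : {fset G}) (v : 'rV[G]_n) :
  reflect (exists s t, [/\ s \in S, t \in T & v = s - const_mx t])
          (v \in S `-D` T).
Proof.
apply: (iffP (imfset2P _ _ _ _ _)) => [[s /= sS [_ /imfsetP[t /= tT ->] ->]]|].
  by exists s, t.
move=> [s [t [sS tT ->]]]; exists s => //; exists (const_mx t) => //.
by apply/imfsetP; exists t.
Qed.

Lemma in_prodv (m n : nat) (S : {fset 'rV[G]_m}) (T : {fset 'rV[G]_n})
    (v : 'rV[G]_(m + n)) :
  (v \in S `x` T) = (lsubmx v \in S) && (rsubmx v \in T).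
Proof.
apply/(imfset2P _ _ _ _ _)/andP => [[s /= sS [t /= tT ->]]|[vS vT]].
  by rewrite row_mxKl row_mxKr.
by exists (lsubmx v) => //; exists (rsubmx v) => //; rewrite hsubmxK.
Qed.

Lemma in_fset_rV1 (T : {fset G}) (v : 'rV[G]_1) :
  (v \in fset_rV1 T) = (v 0 0 \in T).
Proof.
apply/imfsetP/idP => [[t /= tT ->]|vT]; first by rewrite mxE.
by exists (v 0 0) => //; apply/rowP => i; rewrite mxE ord1.
Qed.

Lemma card_prodv_diffset_le (k l : nat) (W : {fset 'rV[G]_l})
    (Y : {fset 'rV[G]_k}) (X Z : {fset G}) :
  (#|` W `x` fset_rV1 X| * #|` Y `-D` Z|
     <= #|` (Y `x` W `x` fset_rV1 Z) `-D` X|)%N.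
Proof.
have [g gP] := @imfset_section _ _ (0, 0)
  (fun p : 'rV[G]_k * G => p.1 - const_mx p.2) (Y `*` Z).
have {}gP u : u \in Y `-D` Z ->
    [/\ (g u).1 \in Y, (g u).2 \in Z & (g u).1 - const_mx (g u).2 = u].
  case/in_diffsetP => y [z [yY zZ uE]].
  have [|] := gP u; first by exists (y, z); rewrite // in_fsetM yY.
  by rewrite in_fsetM => /andP[].
(* Here [s] is [(w, x)] and [g u] is the chosen pair [(y, z)]; the value of [f] is
   [(y, w, z) - Delta(x)], written block by block. *)
rewrite -cardfsM; pose f (p : 'rV[G]_(l + 1) * 'rV[G]_k) : 'rV[G]_(k + l + 1) :=
  let: (s, u) := p in let: (y, z) := g u in let x := rsubmx s 0 0 in
  row_mx (row_mx (y - const_mx x) (lsubmx s - const_mx x)) (const_mx (z - x)).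
apply: (@leq_card_fset_inj _ _ f) => [[s u] [s' u']|[s u]].
  rewrite !in_fsetM /= => /andP[_ /gP[_ _ uE]] /andP[_ /gP[_ _ uE']].
  case gu: (g u) uE => [y z] /= uE.
  case gu': (g u') uE' => [y' z'] /= uE'.
  case/eq_row_mx => /eq_row_mx[yE wE] /rowP/(_ 0); rewrite mxE [RHS]mxE => zE.
  (* A common shift cancels in a difference: with [a = z] and [b = x] this expresses
     [u = y - Delta(z)] through the blocks [y - Delta(x)] and [z - x] of the image. *)
  have shiftE n (v : 'rV[G]_n) (a b : G) :
      v - const_mx a = v - const_mx b - const_mx (a - b).
    by apply/rowP => i; rewrite !mxE opprB addrA subrK.
  have uu' : u = u'.
    by rewrite -uE -uE' (shiftE _ y z (rsubmx s 0 0)) yE zE -shiftE.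
  (* Equal [u] have the same chosen pair, so [z] cancels in [zE] and gives equal [x], which in turn
     cancels in [wE]. *)
  move: gu zE wE; rewrite uu' gu' => -[_ <-] /addrI /oppr_inj xE.
  rewrite xE => /addIr wE; congr (_, _).
  rewrite -[s]hsubmxK -[s']hsubmxK wE; congr row_mx.
  by apply/rowP => i; rewrite ord1.
rewrite in_fsetM in_prodv in_fset_rV1 /= => /andP[/andP[wW xX] /gP[]].
case: (g u) => y z /= yY zZ _; apply/in_diffsetP.
exists (row_mx (row_mx y (lsubmx s)) (const_mx z)), (rsubmx s 0 0); split => //.
  by rewrite !in_prodv in_fset_rV1 !row_mxKl !row_mxKr mxE yY wW.
rewrite -!row_mx_const !opp_row_mx !add_row_mx; congr row_mx.
by apply/rowP => i; rewrite !mxE.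
Qed.

Lemma card_boxprod_diffset_le (k : nat) (A : 'I_k -> {fset G}) (B : {fset G})
    (m : 'I_k) :
  (#|` boxprod A `-D` B|
     <= #|` boxprod (family_take m A) `-D` A m|
        * #|` boxprod (family_drop m A) `-D` B|)%N.
Proof.
rewrite -cardfsM; pose lemk := ltnW (ltn_ord m).
pose lo (i : 'I_m) := widen_ord lemk i.
pose hi (i : 'I_(k - m)) := cast_ord (subnKC lemk) (rshift m i).
pose f (v : 'rV[G]_k) := (\row_i (v 0 (lo i) - v 0 m), \row_i v 0 (hi i)).
apply: (@leq_card_fset_inj _ _ f) => [v v' _ _ [/rowP loE /rowP hiE]|].
  (* The second block starts with coordinate [m] itself, so the subtracted term [v 0 m] is known
     before the coordinates below [m] are recovered. *)
  have geE (i : 'I_k) : (m <= i)%N -> v 0 i = v' 0 i.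
    move=> lemi; have lti : (i - m < k - m)%N by rewrite ltn_sub2r.
    have := hiE (Ordinal lti); rewrite !mxE.
    by have -> : hi (Ordinal lti) = i by apply: val_inj; rewrite /= subnKC.
  apply/rowP => i; have [/geE//|ltim] := leqP m i.
  have := loE (Ordinal ltim); rewrite !mxE (geE m) // => /addIr.
  by have -> : lo (Ordinal ltim) = i by apply: val_inj.
move=> _ /in_diffsetP[a [b [/in_boxprod aA bB ->]]].
rewrite in_fsetM; apply/andP; split; apply/in_diffsetP.
  (* For [v = a - Delta(b)] the shift [b] cancels in [v_i - v_m = a_i - a_m], which leaves [a_m], an
     element of [A m], as the new shift. *)
  exists (\row_i a 0 (lo i)), (a 0 m); split => //.
    by apply/in_boxprod => i; rewrite mxE; apply: aA.
  by apply/rowP => i; rewrite !mxE opprB addrA subrK.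
exists (\row_i a 0 (hi i)), b; split => //.
  by apply/in_boxprod => i; rewrite mxE; apply: aA.
by apply/rowP => i; rewrite !mxE.
Qed.

Lemma card_prodv_diffset_swap_le (k : nat) (Y : {fset 'rV[G]_k})
    (X Z : {fset G}) :
  (#|` (Y `x` fset_rV1 Z) `-D` X| <= #|` (Y `x` fset_rV1 X) `-D` Z|)%N.
Proof.
pose f (v : 'rV[G]_(k + 1)) : 'rV[G]_(k + 1) :=
  row_mx (lsubmx v - const_mx (rsubmx v 0 0)) (- rsubmx v).
apply: (@leq_card_fset_inj _ _ f) => [v v' _ _ /eq_row_mx[lE /oppr_inj rE]|].
  by move: lE; rewrite rE => /addIr lE; rewrite -[v]hsubmxK -[v']hsubmxK lE rE.
move=> _ /in_diffsetP[s [x [+ xX ->]]].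
rewrite in_prodv in_fset_rV1 -[s in s - _]hsubmxK.
move: (lsubmx s) (rsubmx s) => y z /andP[yY zZ]; apply/in_diffsetP.
(* The map [f] sends [(y - Delta(x), z - x)] to [(y - Delta(z), x - z)], which is
   [(y, x) - Delta(z)]. *)
exists (row_mx y (const_mx x)), (z 0 0); split => //.
  by rewrite in_prodv in_fset_rV1 row_mxKl row_mxKr mxE yY.
rewrite /f -!row_mx_const !opp_row_mx !add_row_mx row_mxKl row_mxKr.
congr row_mx; apply/rowP => i; rewrite !mxE; first by rewrite opprB addrA subrK.
by rewrite ord1 opprB.
Qed.

End DiffsetCard.

Theorem theorem1 (k : nat) (hk : (1 <= k)%N) (G : zmodType)
    (A : 'I_k -> {fset G}) (B : {fset G})
    (W Y : {fset 'rV[G]_k}) (X Z : {fset G}) :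
  [/\ (#|` W `x` fset_rV1 X| * #|` Y `-D` Z|
         <= #|` (Y `x` W `x` fset_rV1 Z) `-D` X|)%N,
      (forall m : 'I_k, (1 <= m)%N ->
        (#|` boxprod A `-D` B|
           <= #|` boxprod (family_take m A) `-D` A m|
              * #|` boxprod (family_drop m A) `-D` B|)%N)
    & #|` (Y `x` fset_rV1 Z) `-D` X| = #|` (Y `x` fset_rV1 X) `-D` Z| ].
Proof.
split=> [|m _|]; first exact: card_prodv_diffset_le.
  exact: card_boxprod_diffset_le.
(* Exchanging [X] and [Z] in the swap inequality gives the reverse inequality. *)
by apply/eqP; rewrite eqn_leq !card_prodv_diffset_swap_le.
Qed.
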